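(* Let $s=1+q$ with $q$ a prime power, and let $n=s^2-s+1$. Then there is a perfect difference set $S\subset\mathbb{Z}_n$ with $|S|=s$ and, for every integer $m\ge 1$, the bipartite graph $G_m(S)$ has $(m+1)n$ vertices, is biregular with degrees $r=ms$ and $s$ (all vertices of one stable set have degree $ms$ and all vertices of the other have degree $s$), and has diameter $3$.
   Context: A perfect difference set $S$ in $\mathbb{Z}_n$ is a subset such that every nonzero element of $\mathbb{Z}_n$ occurs exactly once in the multiset $\{t-t' : t,t'\in S\}$. For a finite group $\Gamma$ (here $\Gamma=\mathbb{Z}_n$, written additively), $S\subseteq\Gamma$ and an integer $m\ge1$, $G_m(S)=(V_0\cup V_1,E)$ is the bipartite graph with stable sets $V_0=\{(0,u):u\in\Gamma\}$ and $V_1=\{(l,v): v\in\Gamma,\ 1\le l\le m\}$, and adjacencies $(l,v)\sim(0,v+\sigma)$ for all $\sigma\in S$, $v\in\Gamma$ and $l\in\{1,\dots,m\}$. *)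

(* Defs.v *)
From mathcomp Require Import all_boot all_order all_algebra.

Set Implicit Arguments.
Unset Strict Implicit.
Unset Printing Implicit Defensive.

Import GRing.Theory.
Local Open Scope ring_scope.

Definition prime_power (q : nat) : Prop :=
  exists p k : nat, [/\ prime p, (0 < k)%N & q = (p ^ k)%N].

Definition perfect_difference_set (gT : finZmodType) (S : {set gT}) : Prop :=
  forall x : gT, x != 0 ->
    #|[set tt : gT * gT | [&& tt.1 \in S, tt.2 \in S & tt.1 - tt.2 == x]]| = 1%N.

Record sgraph := SGraph {
  vertex :> finType;
  adj : rel vertex;
  adj_sym : symmetric adj;
  adj_irr : irreflexive adj
}.

Definition degree (G : sgraph) (x : G) : nat := #|[set y | adj x y]|.

Definition stable (G : sgraph) (A : {set G}) : Prop :=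
  {in A &, forall x y, ~~ adj x y}.

Definition bipartition (G : sgraph) (A B : {set G}) : Prop :=
  [/\ A :|: B = [set: G], [disjoint A & B], stable A & stable B].

Definition biregular (G : sgraph) (A B : {set G}) (a b : nat) : Prop :=
  [/\ bipartition A B, {in A, forall x, degree x = a}
    & {in B, forall x, degree x = b}].

Definition walk (G : sgraph) (k : nat) (x y : G) : Prop :=
  exists w : k.-tuple G, path (@adj G) x w /\ last x w = y.

Definition is_dist (G : sgraph) (x y : G) (d : nat) : Prop :=
  walk d x y /\ forall k, walk k x y -> (d <= k)%N.

(* In particular G is connected, since every pair of vertices has a distance. *)
Definition has_diameter (G : sgraph) (d : nat) : Prop :=
  (forall x y : G, exists2 k, is_dist x y k & (k <= d)%N) /\
  exists x y : G, is_dist x y d.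

Section DifferenceGraph.

Variables (gT : finZmodType) (m : nat) (S : {set gT}).

(* A pair (l, v) with l = 0 lies in V_0, and one with 1 <= l <= m in V_1. *)
Definition diff_vertex : finType := ('I_m.+1 * gT)%type.

(* x = (l, v) with l >= 1 and y = (0, v + sigma) for some sigma in S. *)
Definition diff_edge (x y : diff_vertex) : bool :=
  [&& x.1 != ord0, y.1 == ord0 & [exists sigma in S, y.2 == x.2 + sigma]].

Definition diff_adj : rel diff_vertex :=
  fun x y => diff_edge x y || diff_edge y x.

Lemma diff_adj_sym : symmetric diff_adj.
Proof. by move=> x y; rewrite /diff_adj orbC. Qed.

Lemma diff_adj_irr : irreflexive diff_adj.
Proof. by move=> x; rewrite /diff_adj /diff_edge orbb; case: eqP. Qed.

Definition diff_graph : sgraph := SGraph diff_adj_sym diff_adj_irr.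

Definition diff_V0 : {set diff_graph} := [set x : diff_vertex | x.1 == ord0].
Definition diff_V1 : {set diff_graph} := [set x : diff_vertex | x.1 != ord0].

End DifferenceGraph.

(* Main.v *)
(* Singer's difference set is S = {i : Tr(g^i) = 0}, with g a primitive element
   of GF(q^3), Tr the trace to GF(q), and exponents read modulo
   n = (q^3 - 1)/(q - 1), which is legitimate because g^n lies in GF(q).
   - Every nonzero x is a difference: with y = g^x, which is not in GF(q), the
     element h = y^(q^2) - y^q is nonzero and Tr(h) = Tr(y h) = 0.
   - The trace is a polynomial of degree q^2, so |S| <= q + 1.
   There are n - 1 = q (q + 1) nonzero residues and |S| (|S| - 1) ordered pairs
   of distinct elements of S, so each residue is hit exactly once and
   |S| = q + 1.
   In G_m(S), two vertices on the same side have a common neighbour because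
   their group coordinates differ by a difference of elements of S; this bounds
   the diameter by 3, and a nonadjacent pair on opposite sides attains it
   because |S| < n. *)
Require Import Defs.
From mathcomp Require Import all_boot all_order all_algebra all_solvable all_field.
From mathcomp Require Import zify ring.

Import GRing.Theory.
Local Open Scope ring_scope.

(** * Counting differences in a finite abelian group *)

Section PerfectDifferenceSets.

Variables (gT : finZmodType) (S : {set gT}).

Let dif (x : gT) :=
  [set tt : gT * gT | [&& tt.1 \in S, tt.2 \in S & tt.1 - tt.2 == x]].

(** Double counting: each ordered pair from [S] has exactly one difference, and the difference 0
    comes from the diagonal pairs alone. *)
Lemma sum_card_differences :
  (\sum_(x | x != 0%R) #|dif x| + #|S| = #|S| ^ 2)%N.
Proof.
have dif0 : #|dif 0| = #|S|.
  rewrite -(card_imset (mem S) (f := fun t => (t, t))); last by move=> ? ? [].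
  apply: eq_card => -[t t']; rewrite inE /= subr_eq0; apply/and3P/imsetP.
    by move=> [tS _ /eqP <-]; exists t.
  by move=> [u uS [-> ->]].
rewrite addnC -{1}dif0.
transitivity (\sum_x #|dif x|)%N; first by rewrite [RHS](bigD1 (0 : gT)).
rewrite expnS expn1 -cardsX; symmetry.
rewrite -sum1_card (partition_big (fun tt : gT * gT => tt.1 - tt.2) predT) //=.
apply: eq_bigr => x _; rewrite -sum1_card; apply: eq_bigl => tt.
by rewrite !inE andbA.
Qed.

Lemma sum_nonzero_1 : (\sum_(x : gT | x != 0%R) 1 = #|gT|.-1)%N.
Proof. by rewrite sum1_card -(cardC1 (0 : gT)). Qed.

Lemma perfect_difference_set_card :
  perfect_difference_set S -> (#|gT|.-1 + #|S| = #|S| ^ 2)%N.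
Proof.
move=> pS; rewrite -sum_card_differences; congr addn.
by rewrite -sum_nonzero_1; apply: eq_bigr => x /pS ->.
Qed.

(** Covering makes each count at least 1, and the size bound makes their sum at most the number of
    terms; the equality case of the summed inequality then forces every count to be 1. *)
Lemma covering_perfect_difference_set :
  (forall x, x != 0 -> exists t t', [/\ t \in S, t' \in S & t - t' = x]) ->
  (#|S| ^ 2 <= #|gT|.-1 + #|S|)%N -> perfect_difference_set S.
Proof.
move=> cov; rewrite -sum_card_differences leq_add2r -sum_nonzero_1 => le.
have leif : forall x, x != 0 -> (1 <= #|dif x| ?= iff (1%N == #|dif x|))%N.
  move=> x /cov [t [t' [tS t'S tt']]]; split=> //; apply/card_gt0P.
  by exists (t, t'); rewrite inE tS t'S tt' /=.
have [ge /esym] := leqif_sum leif.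
rewrite eqn_leq le ge /= => h x x0.
by move: h => /forallP/(_ x)/implyP/(_ x0)/eqP.
Qed.

Lemma perfect_difference_setP (x : gT) : perfect_difference_set S -> x != 0 ->
  exists t t', [/\ t \in S, t' \in S & t - t' = x].
Proof.
move=> pS /pS c; have /card_gt0P[[t t']] : (0 < #|dif x|)%N by rewrite c.
by rewrite inE => /and3P[tS t'S /eqP <-]; exists t, t'.
Qed.

End PerfectDifferenceSets.

(** * Adjacency, degrees and parity in the difference graph *)

Section DifferenceGraphs.

Variables (gT : finZmodType) (m : nat) (S : {set gT}).
Local Notation G := (diff_graph m S).

Lemma card_diff_graph : #|G| = ((m + 1) * #|gT|)%N.
Proof. by rewrite card_prod card_ord addn1. Qed.

(** Once the side of the first vertex is known, one orientation of the edge survives, and solving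
    for sigma turns the existential into a membership test. *)
Lemma diff_adj0l u (y : G) :
  adj (s := G) (ord0, u) y = (y.1 != ord0) && (u - y.2 \in S).
Proof.
rewrite /= /diff_adj /diff_edge /=; congr andb.
apply/exists_inP/idP => [[t tS /eqP ->]|uS]; first by rewrite addrAC subrr add0r.
by exists (u - y.2); rewrite // addrC subrK.
Qed.

Lemma diff_adj1l (l : 'I_m.+1) v (y : G) : l != ord0 ->
  adj (s := G) (l, v) y = (y.1 == ord0) && (y.2 - v \in S).
Proof.
rewrite /= /diff_adj /diff_edge /= => l0; rewrite l0 (negPf l0) andbF orbF /=.
congr andb; apply/exists_inP/idP => [[t tS /eqP ->]|uS].
  by rewrite addrAC subrr add0r.
by exists (y.2 - v); rewrite // addrC subrK.
Qed.

Lemma diff_graph_bipartite (x y : G) :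
  adj x y -> (x.1 == ord0) = (y.1 != ord0).
Proof.
case: x => l u; have [->|l0] := eqVneq l ord0.
  by rewrite diff_adj0l => /andP[->].
by rewrite diff_adj1l // => /andP[-> _].
Qed.

Lemma diff_graph_biregular :
  biregular (diff_V0 m S) (diff_V1 m S) (m * #|S|) #|S|.
Proof.
split.
- split.
  + by apply/setP => x; rewrite !inE orbN.
  + by rewrite disjoints_subset; apply/subsetP => x; rewrite !inE negbK.
  + move=> x y; rewrite !inE => x0 y0; apply/negP => /diff_graph_bipartite.
    by rewrite x0 y0.
  + move=> x y; rewrite !inE => x0 y0; apply/negP => /diff_graph_bipartite.
    by rewrite (negPf x0) y0.
- move=> [l u]; rewrite inE /= => /eqP ->.
  have cm : #|[set~ ord0 : 'I_m.+1]| = m by rewrite cardsC1 card_ord.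
  rewrite -[X in (X * _)%N]cm -cardsX /degree.
  (* The neighbours of (0, u) are the (l, u - t) with l nonzero and t in [S]: m choices of l for
     each t. *)
  rewrite -(card_imset _ (f := fun p : 'I_m.+1 * gT => (p.1, u - p.2))); last first.
    by move=> [a b] [c d] [/= -> /addrI/oppr_inj ->].
  apply: (@eq_card G) => -[k v]; rewrite inE diff_adj0l /=; apply/andP/imsetP.
    move=> [k0 vS]; exists (k, u - v); first by rewrite !inE k0.
    by rewrite /= subKr.
  by move=> [[a b]]; rewrite !inE /= => /andP[a0 bS] [-> ->]; rewrite subKr.
- move=> [l v]; rewrite inE /= => l0; rewrite /degree.
  rewrite -(card_imset (mem S) (f := fun t => (ord0 : 'I_m.+1, v + t))); last first.
    by move=> a b [/addrI].
  apply: (@eq_card G) => -[k u]; rewrite inE diff_adj1l //=; apply/andP/imsetP.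
    move=> [/eqP -> uS]; exists (u - v) => //.
    by rewrite addrC subrK.
  by move=> [t tS [-> ->]]; rewrite eqxx addrAC subrr add0r.
Qed.

(** Every edge changes sides. This later rules out lengths 0 and 2 between opposite sides. *)
Lemma walk_parity k (x y : G) : walk k x y ->
  odd k = ((x.1 == ord0) != (y.1 == ord0)).
Proof.
move=> [[w /= /eqP <-] [pw <-]]; elim: w x pw => [|z w IH] x /=.
  by rewrite eqxx.
case/andP => /diff_graph_bipartite -> /IH ->.
by do 2!case: (_ == ord0).
Qed.

End DifferenceGraphs.

(** * Walks and distances in arbitrary graphs *)

Lemma walk1 (G : sgraph) (x y : G) : walk 1 x y <-> adj x y.
Proof.
split=> [[w [pw <-]]|xy]; last by exists [tuple y]; rewrite /= xy.
by case: w pw => -[|z []] //= _ /andP[].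
Qed.

Lemma walk_cons (G : sgraph) k (x y z : G) :
  adj x y -> walk k y z -> walk k.+1 x z.
Proof. by move=> xy [w [pw lw]]; exists [tuple of y :: w]; rewrite /= xy. Qed.

Lemma dist_le_walk (G : sgraph) k (x y : G) : walk k x y ->
  exists2 d, is_dist x y d & (d <= k)%N.
Proof.
(* Tuples of a given length over [G] form a finite type, so having a walk of length [j] is decidable
   and a least length can be extracted. *)
pose wb j := [exists w : j.-tuple G, path (@adj G) x w && (last x w == y)].
have wP j : reflect (walk j x y) (wb j).
  apply: (iffP existsP) => [[w /andP[pw /eqP lw]]|[w [pw lw]]]; exists w => //.
  by rewrite pw lw eqxx.
move=> /wP wk; have ex : exists j, wb j by exists k.
case: (ex_minnP ex) => d /wP wd mind; exists d; last exact: mind.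
by split=> // j /wP; apply: mind.
Qed.

(** * Diameter of the difference graph *)

Section Diameter.

Variables (gT : finZmodType) (m : nat) (S : {set gT}).
Hypotheses (m_gt0 : (0 < m)%N) (pS : perfect_difference_set S).
Hypotheses (S0 : (0 < #|S|)%N) (ST : (#|S| < #|gT|)%N).
Local Notation G := (diff_graph m S).

Lemma walk_same_side (x y : G) : (x.1 == ord0) = (y.1 == ord0) ->
  walk 2 x y.
Proof.
have [t0 t0S] := card_gt0P S0.
have diff_pair (a b : gT) : exists t t', [/\ t \in S, t' \in S & t - t' = a - b].
  (* Perfectness says nothing about the difference 0, which is supplied by an element of the
     nonempty [S]. *)
  have [->|ab] := eqVneq a b; first by exists t0, t0; rewrite !subrr.
  by apply: perfect_difference_setP; rewrite // subr_eq0.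
have l1 : (ord_max : 'I_m.+1) != ord0 by rewrite -val_eqE /= -lt0n.
case: x y => [l u] [l' u'] /=.
have [-> /esym/eqP ->|l0 /esym/negbT l'0] := eqVneq l ord0.
  (* The choice gives u - t = u' - t', the coordinate of a common neighbour in V_1. *)
  have [t [t' [tS t'S tt']]] := diff_pair u u'.
  apply: (@walk_cons G 1 _ (ord_max, u - t)).
    by rewrite diff_adj0l l1 subKr.
  rewrite walk1 diff_adj1l //= (_ : _ - _ = t') //.
  by rewrite opprB addrCA -[u' - u]opprB -tt' subKr.
(* Here u + t = u' + t' is the coordinate of a common neighbour in V_0. *)
have [t [t' [tS t'S tt']]] := diff_pair u' u.
apply: (@walk_cons G 1 _ (ord0, u + t)).
  by rewrite diff_adj1l //= addrAC subrr add0r.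
rewrite walk1 diff_adj0l l'0 /= (_ : _ - _ = t') //.
by rewrite addrAC addrC -[u - u']opprB -tt' subKr.
Qed.

Lemma diff_graph_diameter : has_diameter G 3.
Proof.
have [t0 t0S] := card_gt0P S0.
have l1 : (ord_max : 'I_m.+1) != ord0 by rewrite -val_eqE /= -lt0n.
have walk23 (x y : G) : walk 2 x y \/ walk 3 x y.
  have [/walk_same_side|] := eqVneq (x.1 == ord0) (y.1 == ord0); first by left.
  move=> xy; right; case: x xy => l u /=; have [->|l0] := eqVneq l ord0 => /= xy.
    apply: (@walk_cons G 2 _ (ord_max, u - t0)).
      by rewrite diff_adj0l l1 subKr.
    by apply: walk_same_side; move: xy; rewrite /= (negPf l1); case: (y.1 == ord0).
  apply: (@walk_cons G 2 _ (ord0, u + t0)).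
    by rewrite diff_adj1l //= addrAC subrr add0r.
  by apply: walk_same_side; move: xy => /=; case: (y.1 == ord0).
split=> [x y|].
  by case: (walk23 x y) => /dist_le_walk [d xyd dle]; exists d => //; lia.
(* For u outside [S], (0, u) is not adjacent to ([ord_max], 0), and parity leaves no length below
   3. *)
have [u /negP uS] : exists u, u \notin S.
  apply/existsP; rewrite -negb_forall; apply: contraL ST => /forallP SE.
  by rewrite -leqNgt; apply/subset_leq_card/subsetP => x _.
exists (ord0, u), (ord_max, 0).
have odd_walk k : @walk G k (ord0, u) (ord_max, 0) -> odd k.
  by move/walk_parity => ->; rewrite /= (negPf l1).
have no1 : ~ @walk G 1 (ord0, u) (ord_max, 0).
  by rewrite walk1 diff_adj0l subr0 => /andP[_ /uS].
split; last by case=> [|[|[|k]]] // w; have := odd_walk _ w.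
by case: (walk23 (ord0, u) (ord_max, 0)) => // /odd_walk.
Qed.

End Diameter.

(** * Primitive elements of finite fields and Singer's construction *)

Lemma finField_primitive_root (F : finFieldType) :
  exists g : F, #|F|.-1.-primitive_root g.
Proof.
have F1 : (0 < #|F|.-1)%N.
  rewrite -(cardC1 (0 : F)); apply/card_gt0P.
  by exists 1; rewrite !inE oner_eq0.
suff /hasP[g _ gP] : has #|F|.-1.-primitive_root (enum (predC1 (0 : F))).
  by exists g.
(* The nonzero elements are [#|F|.-1] distinct roots of unity of that order, enough to force a
   primitive one. *)
apply: cyclic.has_prim_root => //; last by rewrite -cardE cardC1.
  apply/allP => x; rewrite mem_enum inE unity_rootE => x0.
  apply/eqP/(mulfI x0); rewrite -exprS mulr1 prednK ?expf_card //; lia.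
exact: enum_uniq.
Qed.

Section Singer.

Variables (L : finFieldType) (q n : nat).
Hypothesis nE : n = (q ^ 2 + q + 1)%N.
Hypothesis q_gt1 : (1 < q)%N.
Hypothesis q_pchar : [pchar L].-nat q.
Hypothesis card_L : #|L| = (q ^ 3)%N.

(** GF(q) is not constructed: its elements appear as the fixed points of [frob], and the trace as
    the sum of the three conjugates. *)
Let frob (x : L) := x ^+ q.
Let trace (x : L) := x + frob x + frob (frob x).

Let frobM x y : frob (x * y) = frob x * frob y. Proof. exact: exprMn. Qed.
Let frobD x y : frob (x + y) = frob x + frob y.
Proof. by rewrite /frob exprDn_pchar. Qed.
Let frobN x : frob (- x) = - frob x. Proof. by rewrite /frob exprNn_pchar. Qed.
Let frob3 x : frob (frob (frob x)) = x.
Proof.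
by rewrite /frob -!exprM -[RHS]expf_card card_L !expnS expn0 muln1 mulnA.
Qed.

Let trace0 : trace 0 = 0.
Proof.
rewrite /trace /frob !expr0n; case: (q) q_gt1 => // k _.
by rewrite !(expr0n, addr0).
Qed.

(* [y^(q^2) - y^q] is the first coordinate of the cross product of [(1, 1, 1)]
   and [(y, y^q, y^(q^2))]; the other two are its conjugates. *)
Let trace_twist y : trace (frob (frob y) - frob y) = 0.
Proof. by rewrite /trace !(frobD, frobN) !frob3; ring. Qed.

Let trace_mul_twist y : trace (y * (frob (frob y) - frob y)) = 0.
Proof. by rewrite /trace !(frobM, frobD, frobN) !frob3; ring. Qed.

Let trace_fixed c x : frob c = c -> trace (c * x) = c * trace x.
Proof. by rewrite /trace !frobM => cE; rewrite !cE !mulrDr. Qed.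

Lemma pred_cube : (q ^ 3).-1 = (n * q.-1)%N.
Proof. by rewrite nE; case: q q_gt1 => // q' _; rewrite !expnS !expn0; nia. Qed.

Lemma card_trace_kernel : (#|[set x | trace x == 0%R]| <= q ^ 2)%N.
Proof.
pose p : {poly L} := 'X + 'X^q + 'X^(q ^ 2).
have p_neq0 : p != 0.
  apply/eqP => /(congr1 (coefp 1)); rewrite /= !coefD coefX !coefXn coef0.
  have [/negPf -> /negPf ->] : (1 != q /\ 1 != q ^ 2)%N.
    by split; apply/eqP; rewrite ?expnS ?expn0; nia.
  by rewrite !addr0 => /eqP; rewrite oner_eq0.
have size_p : (size p <= (q ^ 2).+1)%N.
  have qq : (q <= q ^ 2)%N by rewrite !expnS expn0; nia.
  rewrite (leq_trans (size_polyD _ _)) // geq_max size_polyXn leqnn andbT.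
  rewrite (leq_trans (size_polyD _ _)) // geq_max size_polyX size_polyXn.
  by lia.
rewrite cardE -ltnS; apply: leq_trans size_p; apply: max_poly_roots => //.
  apply/allP => x; rewrite mem_enum inE rootE !hornerE.
  by rewrite /trace /frob -exprM.
exact: enum_uniq.
Qed.

Lemma singer_difference_set :
  exists S : {set 'Z_n}, perfect_difference_set S /\ #|S| = q.+1.
Proof.
have n_gt1 : (1 < n)%N by lia.
have n_gt0 : (0 < n)%N by lia.
have card_Zn : #|'Z_n|.-1 = (q ^ 2 + q)%N by rewrite card_ord Zp_cast // nE addn1.
have ltZn (i : 'Z_n) : (i < n)%N by rewrite -[X in (_ < X)%N](Zp_cast n_gt1).
have [g] := finField_primitive_root L; rewrite card_L pred_cube => gP.
have g_neq0 k : g ^+ k != 0.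
  by rewrite expf_neq0 // (prim_root_eq0 gP); apply/eqP; nia.
(* The order n (q - 1) of [g] divides k n (q - 1). *)
have frob_gn k : frob (g ^+ (k * n)) = g ^+ (k * n).
  apply/eqP; rewrite /frob -exprM (eq_prim_root_expr gP) eqn_mod_dvd; last by nia.
  by rewrite -[X in (_ - X)%N]muln1 -mulnBr subn1 -mulnA dvdn_mull.
have trace_shift a k : (trace (g ^+ (k * n + a)) == 0) = (trace (g ^+ a) == 0).
  by rewrite exprD trace_fixed // mulf_eq0 (negPf (g_neq0 _)).
pose S := [set i : 'Z_n | trace (g ^+ i) == 0].
have natS a : ((a%:R : 'Z_n) \in S) = (trace (g ^+ a) == 0).
  by rewrite inE val_Zp_nat // [in RHS](divn_eq a n) trace_shift.
have cov (x : 'Z_n) : x != 0 ->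
    exists t t', [/\ t \in S, t' \in S & t - t' = x].
  move=> x_neq0; pose y := g ^+ x; pose h := frob (frob y) - frob y.
  have h_neq0 : h != 0.
    (* If [h] vanished, applying [frob] would show that y is fixed, so n would divide x, which is
       less than n. *)
    rewrite subr_eq0; apply: contra_neqN x_neq0 => /eqP fy.
    have /eqP : y = frob y by rewrite -[RHS]fy -{1}(frob3 y) fy.
    rewrite eq_sym /frob /y -exprM (eq_prim_root_expr gP) eqn_mod_dvd; last by nia.
    rewrite -[X in (_ - X)%N]muln1 -mulnBr subn1 dvdn_pmul2r; last by lia.
    move=> /dvdn_leq nx; apply/val_inj => /=; have := ltZn x; lia.
  (* Being nonzero, [h] is a power g^j; then j and x + j are exponents of [h] and [y * h], both of
     trace zero. *)
  have /(prim_rootP gP)[j hE] : h ^+ (n * q.-1) = 1.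
    apply/(mulfI h_neq0); rewrite -exprS mulr1 -pred_cube -card_L.
    rewrite prednK ?expf_card //.
    by rewrite card_L expn_gt0; lia.
  exists (x + j)%:R, j%:R; rewrite !natS exprD -hE trace_mul_twist trace_twist eqxx.
  by split=> //; rewrite natrD addrK natr_Zp.
have S_le : (#|S| <= q.+1)%N.
  (* Each residue in [S] lifts to q - 1 exponents below q^3 - 1, hence to q - 1 distinct nonzero
     elements of trace zero. *)
  pose f (p : 'Z_n * 'I_q.-1) := g ^+ (p.2 * n + p.1).
  have f_inj : injective f.
    move=> [i k] [i' k'] /eqP; rewrite (eq_prim_root_expr gP) /=.
    have := ltn_ord k; have := ltn_ord k'; have := ltZn i; have := ltZn i'.
    move=> ? ? ? ?; rewrite !modn_small; [|nia|nia] => /eqP e.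
    have ek : k = k' :> nat.
      by have := congr1 (divn^~ n) e; rewrite !divnMDl // !divn_small // !addn0.
    congr pair; apply/val_inj => //=; first by move: e; rewrite ek => /addnI.
  have : (#|setX S [set: 'I_q.-1]| <= #|[set x | trace x == 0%R] :\ 0%R|)%N.
    rewrite -(card_imset _ f_inj); apply/subset_leq_card/subsetP => x /imsetP[[i k]].
    by rewrite !inE andbT => iS ->; rewrite g_neq0 trace_shift.
  rewrite cardsX cardsT card_ord => le1; have := card_trace_kernel.
  (* Leaving out 0 gives the strict bound |S| (q - 1) < q^2, whereas (q + 2)(q - 1) >= q^2 for q >=
     2. *)
  rewrite (cardsD1 0) inE trace0 eqxx add1n => /(leq_ltn_trans le1).
  rewrite ltnNge; apply: contraNT; rewrite -ltnNge => Sq.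
  have : (q.+2 * q.-1 <= #|S| * q.-1)%N by rewrite leq_mul2r Sq orbT.
  by apply: leq_trans; rewrite expnS expn1; case: (q) q_gt1 => // k; nia.
have pS : perfect_difference_set S.
  by apply: covering_perfect_difference_set => //;
    rewrite [#|_|.-1]card_Zn; move: #|S| S_le => c; rewrite !expnS !expn0; nia.
(* The equation |S|^2 - |S| = q^2 + q has q + 1 as its only natural solution. *)
exists S; split=> //; have := perfect_difference_set_card _ _ pS.
by rewrite [#|_|.-1]card_Zn; move: #|S| S_le => c; rewrite !expnS !expn0; nia.
Qed.

End Singer.

(* The hypotheses give n >= 7, so 'Z_n is the ring of integers modulo n. *)
Theorem corollary2p3 (q s n : nat) (hq : prime_power q)
    (hs : s = (1 + q)%N) (hn : n = (s ^ 2 - s + 1)%N) :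
  exists S : {set 'Z_n},
    [/\ perfect_difference_set S, #|S| = s
      & forall m : nat, (1 <= m)%N ->
          [/\ #|diff_graph m S| = ((m + 1) * n)%N,
              biregular (diff_V0 m S) (diff_V1 m S) (m * s) s
            & has_diameter (diff_graph m S) 3]].
Proof.
have [p [k [p_prime k_gt0 qE]]] := hq.
have q_gt1 : (1 < q)%N by rewrite qE -(exp1n k) ltn_exp2r ?prime_gt1.
have nE : n = (q ^ 2 + q + 1)%N by rewrite hn hs !expnS !expn0; nia.
(* [L] is the field with p^(3k) = q^3 elements. *)
have [|L pL cL] := @pPrimePowerField p (k * 3) p_prime.
  by rewrite muln_gt0 k_gt0.
have [||S [pS cS]] := singer_difference_set L q n nE q_gt1.
- by rewrite qE pnatX pnatE // pL.
- by rewrite cL qE expnM.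
have card_Zn : #|'Z_n| = n by rewrite card_ord Zp_cast; lia.
have sE : #|S| = s by rewrite cS hs.
exists S; split=> // m m_gt0; split.
- by rewrite card_diff_graph card_Zn.
- by rewrite -sE; exact: diff_graph_biregular.
- by apply: diff_graph_diameter; rewrite ?sE ?card_Zn //; lia.
Qed.
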